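(* Let $G$ be a graph. Then the following statements are equivalent: 1. $G$ does not contain the house as an induced minor. 2. $G$ does not contain an induced subdivision of the house and does not contain an induced long twin wheel.
   Context: Graphs are finite, simple and undirected. $H$ is an induced minor of $G$ if a graph isomorphic to $H$ can be obtained from $G$ by vertex deletions and edge contractions. A subdivision of $H$ is obtained from $H$ by repeatedly (zero or more times) replacing an edge $uv$ by two edges $uw,wv$ with $w$ a new vertex; $G$ contains an induced subdivision of $H$ if some induced subgraph of $G$ is isomorphic to a subdivision of $H$. The house is the graph with vertices $a,b,c,d,e$ and edges $ab,bc,cd,de,ae,ad$. A long twin wheel is a graph consisting of an induced cycle $C$ of length at least $5$ together with one further vertex $v$, called the center, such that $v$ has degree three (all its neighbors lying on $C$) and the neighborhood of $v$ induces a connected subgraph of $C$ (i.e. the neighbors of $v$ are three consecutive vertices of $C$). $G$ contains an induced long twin wheel if some induced subgraph of $G$ is isomorphic to a long twin wheel. *)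

(* Defs.v *)
From mathcomp Require Import all_boot.

Set Implicit Arguments.
Unset Strict Implicit.
Unset Printing Implicit Defensive.

Record sgraph := SGraph {
  vertex :> finType;
  adj : rel vertex;
  adj_sym : symmetric adj;
  adj_irrefl : irreflexive adj }.

Arguments adj {_} : rename.

Definition isomorphic (G H : sgraph) : Prop :=
  exists2 f : G -> H, bijective f & forall x y, adj (f x) (f y) = adj x y.

Definition connected (G : sgraph) : Prop :=
  0 < #|G| /\ forall x y : G, connect adj x y.

Definition nbhd (G : sgraph) (v : G) : {set G} := [set x | adj v x].

Section Induced.
Variables (G : sgraph) (S : {set G}).

Definition induced_adj : rel {x : G | x \in S} :=
  fun x y => adj (val x) (val y).

Fact induced_sym : symmetric induced_adj.
Proof. by move=> x y; apply: adj_sym. Qed.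

Fact induced_irrefl : irreflexive induced_adj.
Proof. by move=> x; apply: adj_irrefl. Qed.

Definition induced : sgraph := SGraph induced_sym induced_irrefl.
End Induced.

Definition contains_induced (G H : sgraph) : Prop :=
  exists S : {set G}, isomorphic (induced S) H.

Definition delete_vertex (G : sgraph) (v : G) : sgraph := induced [set~ v].

(* [contract u v] is meant for adjacent [u] and [v]: [v] is removed and [u]
   stands for the merged vertex, inheriting the neighbors of [v]. *)
Section Contract.
Variables (G : sgraph) (u v : G).

Definition contract_adj : rel {x : G | x != v} := fun x y =>
  (x != y) && [|| adj (val x) (val y),
                  (val x == u) && adj v (val y)
                | (val y == u) && adj v (val x)].

Fact contract_sym : symmetric contract_adj.
Proof.
by move=> x y; rewrite /contract_adj eq_sym adj_sym; congr (_ && (_ || _)); rewrite orbC.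
Qed.

Fact contract_irrefl : irreflexive contract_adj.
Proof. by move=> x; rewrite /contract_adj eqxx. Qed.

Definition contract : sgraph := SGraph contract_sym contract_irrefl.
End Contract.

Inductive del_contr (G : sgraph) : sgraph -> Prop :=
| DelContrRefl : del_contr G G
| DelContrDelete (K : sgraph) (v : K) :
    del_contr G K -> del_contr G (delete_vertex v)
| DelContrContract (K : sgraph) (u v : K) :
    del_contr G K -> adj u v -> del_contr G (contract u v).

Definition induced_minor (H G : sgraph) : Prop :=
  exists2 K, del_contr G K & isomorphic K H.

(* [subdivide_edge u v] is meant for adjacent [u] and [v]; the new vertex
   is [None]. *)
Section Subdivide.
Variables (G : sgraph) (u v : G).

Definition subdivide_adj : rel (option G) := fun x y =>
  match x, y with
  | Some x, Some y =>
      adj x y && ~~ [|| (x == u) && (y == v) | (x == v) && (y == u)]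
  | Some z, None | None, Some z => (z == u) || (z == v)
  | None, None => false
  end.

Fact subdivide_sym : symmetric subdivide_adj.
Proof.
case=> [x|] [y|] //=; rewrite adj_sym orbC.
by rewrite [(x == v) && _]andbC [(x == u) && _]andbC.
Qed.

Fact subdivide_irrefl : irreflexive subdivide_adj.
Proof. by case=> [x|] //=; rewrite adj_irrefl. Qed.

Definition subdivide_edge : sgraph := SGraph subdivide_sym subdivide_irrefl.
End Subdivide.

Inductive subdivision (H : sgraph) : sgraph -> Prop :=
| SubdivisionRefl : subdivision H H
| SubdivisionStep (K : sgraph) (u v : K) :
    subdivision H K -> adj u v -> subdivision H (subdivide_edge u v).

Definition contains_induced_subdivision (G H : sgraph) : Prop :=
  exists2 K, subdivision H K & contains_induced G K.

(* The vertices a, b, c, d, e are 0, 1, 2, 3, 4. *)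
Definition house_edges : seq (nat * nat) :=
  [:: (0, 1); (1, 2); (2, 3); (3, 4); (0, 4); (0, 3)].

Definition house_adj : rel 'I_5 := fun x y =>
  ((val x, val y) \in house_edges) || ((val y, val x) \in house_edges).

Fact house_sym : symmetric house_adj.
Proof. by move=> x y; rewrite /house_adj orbC. Qed.

Fact house_irrefl : irreflexive house_adj.
Proof. by case=> [[|[|[|[|[|]]]]]]. Qed.

Definition house : sgraph := SGraph house_sym house_irrefl.

(* This is the cycle of length [n] when [3 <= n]; [ordS] is the successor
   modulo [n], and [x != y] only matters when [n = 1]. *)
Section Cycle.
Variable n : nat.

Definition cycle_adj : rel 'I_n := fun x y =>
  (x != y) && ((y == ordS x) || (x == ordS y)).

Fact cycle_sym : symmetric cycle_adj.
Proof. by move=> x y; rewrite /cycle_adj eq_sym orbC. Qed.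

Fact cycle_irrefl : irreflexive cycle_adj.
Proof. by move=> x; rewrite /cycle_adj eqxx. Qed.

Definition cycle_graph : sgraph := SGraph cycle_sym cycle_irrefl.
End Cycle.

(* The rim is [C]; all neighbors of [v] lie on it, as [C] contains every other
   vertex, and [C] being induced, [induced (nbhd v)] is a subgraph of it. *)
Definition long_twin_wheel (W : sgraph) : Prop :=
  exists (C : {set W}) (v : W),
    [/\ C = [set~ v],
        exists2 n, 5 <= n & isomorphic (induced C) (cycle_graph n),
        #|nbhd v| = 3
      & connected (induced (nbhd v))].

Definition contains_induced_long_twin_wheel (G : sgraph) : Prop :=
  exists2 W, long_twin_wheel W & contains_induced G W.

(* Main.v *)
Require Import Defs.
From mathcomp Require Import all_boot.
From mathcomp Require Import zify.

Set Implicit Arguments.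
Unset Strict Implicit.
Unset Printing Implicit Defensive.

(** The subdivisions of the house are the theta graphs (two branch vertices
    joined by three internally disjoint paths) other than the two with path
    lengths 1, 2, 2 and 2, 2, 2.  Call such a theta, or a long twin wheel, a
    pattern.

    Having a pattern as an induced subgraph is inherited from [G / uv] by [G]
    ([contract_pattern]), and trivially from [G - v] by [G].  As the house is a
    pattern, a graph with the house as an induced minor contains a pattern.  To
    see that contractions create no pattern, let [w] be the vertex of a pattern
    in [G / uv] that results from merging [u] and [v].  Each neighbor of [w] in
    the pattern is adjacent to [u] or to [v].  If one of the two, say [u], sees
    all of them, then [u] replaces [w].  Otherwise, if [w] has degree 2, the
    pattern reappears with an edge subdivided ([theta_split_path],
    [rim_vertex_split]).  If [w] has degree 3, then [u] and [v] either separate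
    the neighbors of [w], or share exactly one of them.

    For a branch vertex of a theta, separating the neighbors subdivides an
    edge.  A shared neighbor [y] forms a triangle with [u] and [v], and three
    paths lead from this triangle to the other branch vertex [d], one of them
    trivial if [y = d].  Deleting the inner vertices of one of them leaves a
    cycle with a triangle on one of its edges, which is a subdivision of the
    house unless the cycle is too short or the deleted path was an edge.
    The only configuration in which this fails for every path has [d] adjacent
    to [y] and to one of [u] and [v]; it is a long twin wheel
    ([theta_split_branch]).  For a vertex of degree 3 of a long twin wheel,
    deleting [u] or [v] leaves a subdivided house, except for one splitting of
    an end of the three consecutive rim neighbors, which lengthens the rim
    ([twin_wheel_split]).

    Conversely, a subdivided edge can be contracted back, so that an induced
    subdivision of the house yields the house as an induced minor
    ([subdivision_minor]).  In a long twin wheel, contracting an edge between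
    two consecutive neighbors of the center gives a subdivision of the house
    ([twin_wheel_minor]).

    Patterns are handled as graphs on an initial segment of the naturals whose
    adjacency is an arithmetic formula; every replacement of one pattern by
    another is then an explicit renumbering of vertices, and its correctness is
    decided by linear arithmetic. *)

(** * Induced copies of graphs on initial segments of the naturals *)

Definition upper (r : rel nat) : rel nat :=
  fun x y => if x < y then r x y else r y x.

(** [embeds N r G]: the graph on [0, ..., N - 1] in which [x < y] are adjacent
    when [r x y] is an induced subgraph of [G].  Only the values [r x y] with
    [x < y < N] matter, which spares symmetry and irreflexivity proofs and
    leaves statements of pure arithmetic. *)
Definition embeds (N : nat) (r : rel nat) (G : sgraph) : Prop :=
  exists f : nat -> G, forall x y, x < y -> y < N ->
    f x != f y /\ adj (f x) (f y) = r x y.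

Lemma upper_sym (r : rel nat) x y : x != y -> upper r x y = upper r y x.
Proof. by rewrite /upper; case: ltngtP. Qed.

Lemma embeds_upper (G : sgraph) N r (f : nat -> G) :
  (forall x y, x < y -> y < N -> f x != f y /\ adj (f x) (f y) = r x y) ->
  forall x y, x < N -> y < N -> x != y ->
    f x != f y /\ adj (f x) (f y) = upper r x y.
Proof.
move=> fP x y xN yN; rewrite /upper; case: ltngtP => // xy _; first exact: fP.
by rewrite eq_sym adj_sym; apply: fP.
Qed.

Lemma embeds_sub M r' N r G (g : nat -> nat) :
  embeds N r G ->
  (forall x y, x < y -> y < M -> forall a b, a = g x -> b = g y ->
    [/\ a < N, b < N, a != b & r' x y = upper r a b]) ->
  embeds M r' G.
Proof.
move=> [f fP] gP; exists (f \o g) => x y xy yM /=.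
have [aN bN ab ->] := gP x y xy yM _ _ erefl erefl.
exact: embeds_upper fP _ _ aN bN ab.
Qed.

(** [theta N i j] is the theta graph with branch vertices [i] and [j], numbered
    along a Hamiltonian path: the inner vertices of a first path from [i] to
    [j], then [j], the inner vertices of a second path, [i], and the inner
    vertices of a third path from [i] to [j].  For [0 < i < j < N - 1] the three
    paths have lengths [i + 1], [j - i] and [N - j]. *)
Definition theta N i j : rel nat := fun x y =>
  [|| y == x.+1, (x == 0) && (y == j) | (x == i) && (y == N.-1)].

(** The thetas that are subdivisions of the house: at most one path is an edge,
    which the numbering makes the second one, and the path lengths are neither
    2, 1, 2 nor 2, 2, 2. *)
Definition house_theta N i j :=
  [&& 0 < i, i < j, j.+1 < N, 4 < N & ~~ [&& N == 5, i == 1 & j == 3]].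

(** The cycle [0, ..., n - 1] together with [n], a true twin of [1]. *)
Definition twin_wheel n : rel nat := fun x y =>
  if y == n then x < 3 else (y == x.+1) || (x == 0) && (y == n.-1).

Definition has_pattern (G : sgraph) : Prop :=
  (exists N i j, house_theta N i j /\ embeds N (theta N i j) G) \/
  (exists2 n, 4 < n & embeds n.+1 (twin_wheel n) G).

(** * Splitting a vertex *)

(** The vertex [k] of the graph [r] on [0, ..., N - 1] is replaced by two
    adjacent vertices [k] and [N], with the neighbors [cu] and [cv]
    respectively. *)
Definition split_vertex (r : rel nat) N k (cu cv : pred nat) : rel nat :=
  fun x y =>
  if y == N then (x == k) || cv x
  else if x == k then cu y else if y == k then cu x else r x y.

(** [G] contains a graph from which [r] results by contracting an edge to the
    vertex [k]. *)
Definition vertex_split (G : sgraph) N r k : Prop :=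
  exists cu cv : pred nat,
    (forall x, x < N -> x != k -> cu x || cv x = upper r k x) /\
    embeds N.+1 (split_vertex r N k cu cv) G.

Lemma contract_adjE (G : sgraph) (u v : G) (x y : contract u v) :
  adj x y = (x != y) && [|| adj (sval x) (sval y),
    (sval x == u) && adj v (sval y) | (sval y == u) && adj v (sval x)].
Proof. by []. Qed.

(** A copy in [contract u v] that avoids the merged vertex is a copy in [G]; in
    any other copy, expanding the merged vertex splits the vertex that is mapped
    to it. *)
Lemma contract_embeds (G : sgraph) (u v : G) N r : adj u v ->
  embeds N r (contract u v) ->
  embeds N r G \/ exists2 k, k < N & vertex_split G N r k.
Proof.
move=> uv [f fP]; have fU := embeds_upper fP.
have fv x : (sval (f x) == v) = false by apply/negbTE/(valP (f x)).
case: (boolP (has (fun x => sval (f x) == u) (iota 0 N))) => [/hasP|/hasPn] H.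
  right; have [k] := H; rewrite mem_iota add0n /= => kN /eqP fk.
  have fu x : x < N -> x != k -> (sval (f x) == u) = false.
    by move=> xN xk; rewrite -fk; apply/negbTE; have [] := fU x k xN kN xk.
  exists k => //.
  exists (fun x => adj u (sval (f x))), (fun x => adj v (sval (f x))).
  split=> [x xN xk|].
    have [fkx <-] : f k != f x /\ adj (f k) (f x) = upper r k x.
      by apply: fU; rewrite // eq_sym.
    by rewrite contract_adjE fkx fk eqxx (fu x) //= orbF.
  exists (fun x => if x == N then v else sval (f x)) => x y xy yN.
  have xN : x < N by lia.
  rewrite /split_vertex (ltn_eqF xN); case: (y =P N) => [_|/eqP yN'].
    rewrite fv; split=> //.
    case: (x =P k) => [->|/eqP xk] /=; first by rewrite fk.
    by rewrite adj_sym.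
  have {}yN : y < N by lia.
  have [fxy rxy] := fP x y xy yN; split=> //.
  case: (x =P k) => [->|/eqP xk]; first by rewrite fk.
  case: (y =P k) => [->|/eqP yk]; first by rewrite fk adj_sym.
  by rewrite -rxy /= /contract_adj fxy !fu //= orbF.
left; exists (fun x => sval (f x)) => x y xy yN; have xN := ltn_trans xy yN.
have [fxy <-] := fP x y xy yN; split=> //.
have fu z : z < N -> (sval (f z) == u) = false.
  by move=> zN; apply/negbTE/H; rewrite mem_iota.
by rewrite contract_adjE fxy !fu //= orbF.
Qed.

Lemma delete_embeds (G : sgraph) (v : G) N r :
  embeds N r (delete_vertex v) -> embeds N r G.
Proof. by move=> [f fP]; exists (val \o f) => x y xy yN; apply: fP. Qed.

Lemma split_upper r N k cu cv a b : a < N -> b < N -> a != b ->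
  upper (split_vertex r N k cu cv) a b =
    if a == k then cu b else if b == k then cu a else upper r a b.
Proof.
rewrite /upper /split_vertex => aN bN ab; rewrite (ltn_eqF aN) (ltn_eqF bN).
case: ltngtP ab => // ab _.
by case: (b =P k) => [bk|//]; case: (a =P k) => // ak; lia.
Qed.

Lemma split_upper_last r N k cu cv a : a < N ->
  upper (split_vertex r N k cu cv) a N = (a == k) || cv a.
Proof. by move=> aN; rewrite /upper /split_vertex aN eqxx. Qed.

(** An isomorphism onto a renumbered graph carries splittings of a vertex over
    to splittings of the corresponding vertex. *)
Lemma split_relabel (G : sgraph) N r k cu cv r' k' cu' cv' (g : nat -> nat) :
  embeds N.+1 (split_vertex r N k cu cv) G -> k' < N -> g k' = k ->
  (forall x, x < N -> g x < N) ->
  (forall x y, x < y -> y < N ->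
     g x != g y /\ r' x y = upper r (g x) (g y)) ->
  (forall x, x < N -> x != k' -> cu' x = cu (g x) /\ cv' x = cv (g x)) ->
  embeds N.+1 (split_vertex r' N k' cu' cv') G.
Proof.
move=> emb k'N gk' gN gP cP.
have gk x : x < N -> (g x == k) = (x == k').
  move=> xN; rewrite -gk'; case: (ltngtP x k') => [lt|lt|->]; last exact: eqxx.
    by apply/negbTE; have [] := gP x k' lt k'N.
  by rewrite eq_sym; apply/negbTE; have [] := gP k' x lt xN.
apply: (embeds_sub (g := fun x => if x == N then N else g x) emb).
move=> x y xy yN a b; have xN : x < N by lia.
rewrite (ltn_eqF xN) => -> {a}; have gxN := gN x xN.
case: (y =P N) => [->|/eqP yN'] ->.
  rewrite split_upper_last // gk // /split_vertex eqxx neq_ltn gxN.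
  split=> //; first exact: leqW.
  by case: (x =P k') => //= /eqP xk; have [_ ->] := cP x xN xk.
have {}yN : y < N by lia.
have gyN := gN y yN; have [gxy rxy] := gP x y xy yN.
rewrite split_upper // !gk // /split_vertex (ltn_eqF yN) rxy.
split=> //; [exact: leqW | exact: leqW |].
case: (x =P k') => [ex|/eqP xk].
  by have [|-> _] := cP y yN; first lia.
by case: (y =P k') => // ey; have [-> _] := cP x xN xk.
Qed.

Lemma vertex_split_relabel (G : sgraph) N r k r' k' (g : nat -> nat) :
  vertex_split G N r k -> k' < N -> g k' = k ->
  (forall x, x < N -> g x < N) ->
  (forall x y, x < y -> y < N ->
     g x != g y /\ r' x y = upper r (g x) (g y)) ->
  vertex_split G N r' k'.
Proof.
move=> [cu [cv [cov emb]]] k'N gk' gN gP.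
exists (cu \o g), (cv \o g); split=> [x xN xk|]; last first.
  exact: split_relabel emb k'N gk' gN gP _.
have gU a b : a < b -> b < N ->
    g a != g b /\ upper r' a b = upper r (g a) (g b).
  by move=> ab bN; rewrite {1}/upper ab; apply: gP.
have [gxk ->] : g x != k /\ upper r' k' x = upper r k (g x).
  rewrite -gk'; case: (ltngtP x k') xk => // lt _.
    have [ne rE] := gU _ _ lt k'N; split=> //.
    by rewrite upper_sym ?gtn_eqF // rE upper_sym.
  by have [ne rE] := gU _ _ lt xN; rewrite eq_sym.
by apply: cov => //; apply: gN.
Qed.

Lemma vertex_split_swap (G : sgraph) N r k cu cv : k < N ->
  embeds N.+1 (split_vertex r N k cu cv) G ->
  embeds N.+1 (split_vertex r N k cv cu) G.
Proof.
move=> kN.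
move/(embeds_sub (g := fun x =>
  if x == N then k else if x == k then N else x)).
apply=> x y xy yN a b; have xN : x < N by lia.
rewrite (ltn_eqF xN).
case: (y =P N) => [->|/eqP yN'] -> ->;
  rewrite /split_vertex ?eqxx ?(negbTE yN').
  case: (x =P k) => [->|/eqP xk].
    by rewrite upper_sym ?split_upper_last ?eqxx //; [split|]; lia.
  rewrite split_upper // (negbTE xk) eqxx; split=> //; lia.
case: (x =P k) => [ex|/eqP xk].
  have [yk yN2] : y != k /\ y < N by lia.
  rewrite (negbTE yk) upper_sym ?split_upper_last ?(negbTE yk) //; last lia.
  by split; lia.
case: (y =P k) => [ey|/eqP yk].
  rewrite split_upper_last // (negbTE xk); split=> //; lia.
have yN2 : y < N by lia.
by rewrite split_upper ?(negbTE xk) ?(negbTE yk) /upper ?xy //; [split|]; lia.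
Qed.

(** The neighbors of a vertex as a list, so that the ways in which they can be
    shared out between the two parts of a split vertex can be enumerated. *)
Definition neighbors (r : rel nat) N k (ns : seq nat) :=
  forall x, (x \in ns) = [&& x < N, x != k & upper r k x].

Lemma vertex_split_neighbors (G : sgraph) N r k ns :
  vertex_split G N r k -> neighbors r N k ns -> k < N ->
  exists cu cv : pred nat, all (fun x => cu x || cv x) ns /\
    embeds N.+1
      (split_vertex r N k (mem (filter cu ns)) (mem (filter cv ns))) G.
Proof.
move=> [cu [cv [cov emb]]] nsP kN; exists cu, cv; split.
  by apply/allP => x; rewrite nsP => /and3P[xN xk]; rewrite cov.
have memE x : x < N -> x != k ->
    (x \in filter cu ns = cu x) * (x \in filter cv ns = cv x).
  move=> xN xk; rewrite !mem_filter nsP xN xk -cov //=.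
  by case: (cu x); case: (cv x).
apply: (split_relabel (g := id) emb) => // [x y xy yN|x xN xk].
  by rewrite /upper xy neq_ltn xy.
by have [cuE cvE] := memE x xN xk.
Qed.

(** A part of the split vertex that keeps all neighbors replaces the vertex. *)
Lemma split_full (G : sgraph) N r k ns cv : neighbors r N k ns -> k < N ->
  embeds N.+1 (split_vertex r N k (mem ns) cv) G -> embeds N r G.
Proof.
move=> nsP kN emb; apply: (embeds_sub (g := id) emb) => x y xy yN _ _ -> ->.
have xN : x < N by lia.
split; [lia|lia|lia|].
rewrite split_upper //; last by lia.
rewrite /upper xy.
case: (x =P k) => [ex|/eqP xk].
  by rewrite [mem ns y]nsP /upper -ex xy; case: eqP => // eyx; lia.
case: (y =P k) => // ey.
by rewrite [mem ns x]nsP /upper -ey xN (ltn_eqF xy) ltnNge (ltnW xy).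
Qed.

(** * Reduction of adjacency formulas to linear arithmetic *)

(* An equation between Boolean combinations of comparisons has far too many
   cases for one call of [lia].  Deciding one comparison at a time discards the
   contradictory branches early. *)
Ltac prune := try (exfalso; lia).

Ltac decide_atoms :=
  rewrite /= ?orbT ?orbF ?andbT ?andbF ?orbT ?orbF /=; try done;
  match goal with
  | |- context [@eq_op _ ?m ?n] => case: (@eqP _ m n) => ?; prune; decide_atoms
  | |- context [leq ?m ?n] => case: (leqP m n) => ?; prune; decide_atoms
  end.

Ltac decide_if b :=
  lazymatch b with
  | (?m == ?n) => case: (@eqP _ m n) => ?
  | (?m < ?n) => case: (ltnP m n) => ?
  | _ => case: (boolP b) => ?
  end; prune.

Ltac decide_ifs :=
  repeat match goal with |- context [if ?b then _ else _] => decide_if b end.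

(* In a goal [a = if _ then _ else _ -> _], substitutes the value for [a] in
   every branch; this has to precede the unfolding of the relations, where [a]
   occurs many times. *)
Ltac substitute_value :=
  repeat match goal with
         | |- _ = (if ?b then _ else _) -> _ => decide_if b
         end; move=> ->.

Ltac name_value e :=
  let a := fresh in let ea := fresh in
  have [a ea] : exists a, a = e by [exists e]; rewrite -!ea; move: ea.

Ltac embed_by g :=
  move/(embeds_sub (g := g)); apply; move=> x y xy yM a b /=;
  do 2!substitute_value; (split; [lia | lia | lia |]);
  rewrite /upper /split_vertex /twin_wheel /theta ?inE /=;
  decide_ifs; decide_atoms.

Ltac list_neighbors :=
  move=> x; rewrite !inE /upper /theta /twin_wheel; decide_ifs; decide_atoms.

(* Discharges the conditions of [split_relabel] and [vertex_split_relabel]. *)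
Ltac relabel_by :=
  rewrite /=;
  first
  [ by decide_ifs; lia
  | move=> x xN; by decide_ifs; lia
  | move=> x y xy yN;
    match goal with |- is_true (?m != ?n) /\ _ =>
      name_value m; substitute_value; name_value n; substitute_value end;
    (split; [lia|]); rewrite /upper /theta /twin_wheel /=;
    decide_ifs; decide_atoms
  | move=> x xN xk; rewrite !inE; split; decide_ifs; decide_atoms ].

(** * Splitting a vertex of a theta *)

Lemma has_theta (G : sgraph) N i j :
  house_theta N i j -> embeds N (theta N i j) G -> has_pattern G.
Proof. by move=> Nij emb; left; exists N, i, j. Qed.

(** [theta N 1 2] is the cycle [1, ..., N - 1] with its edge from [1] to [2]
    capped by [0], that is, a house whose square may be subdivided. *)
Lemma has_capped_cycle (G : sgraph) N :
  4 < N -> embeds N (theta N 1 2) G -> has_pattern G.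
Proof. by move=> N_gt4; apply: has_theta; rewrite /house_theta; lia. Qed.

Section ThetaSplit.

Variables (G : sgraph) (N i j : nat).
Hypotheses (i_gt0 : 0 < i) (lt_ij : i < j) (lt_jN : j.+1 < N) (N_gt4 : 4 < N).

(* The neighbors of a vertex of degree 2: its predecessor and successor on the
   Hamiltonian path, or a branch vertex if it is an end of that path. *)
Let path_left k := if k == 0 then j else k.-1.
Let path_right k := if k == N.-1 then i else k.+1.

Lemma path_neighbors k : k < N -> k != i -> k != j ->
  neighbors (theta N i j) N k [:: path_left k; path_right k].
Proof.
by move=> kN /eqP ki /eqP kj; rewrite /path_left /path_right; list_neighbors.
Qed.

Lemma path_split k : k < N -> k != i -> k != j ->
  embeds N.+1 (split_vertex (theta N i j) N k
    (mem [:: path_right k]) (mem [:: path_left k])) G -> has_pattern G.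
Proof.
move=> kN /eqP ki /eqP kj; rewrite /path_left /path_right => emb.
apply: (@has_theta _ N.+1 (if k < i then i.+1 else i)
                          (if k < j then j.+1 else j)).
  by rewrite /house_theta; do 2!case: ifP => ?; lia.
move: emb; case: (ltnP k i) => ?; case: (ltnP k j) => ?; prune;
  embed_by (fun x => if x < k then x else if x == k then N else x.-1).
Qed.

Let split_at (s t : seq nat) :=
  embeds N.+1 (split_vertex (theta N i j) N i (mem s) (mem t)) G.

(** The neighbors of [i] on the first, second and third path. *)
Lemma branch_neighbors : neighbors (theta N i j) N i [:: i.-1; i.+1; N.-1].
Proof. list_neighbors. Qed.

(** The part of the split vertex with two of the three neighbors becomes the
    branch vertex, the other part an inner vertex of the remaining path.  This
    and the next two lemmas insert it in the first, second or third path. *)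
Lemma branch_split_first : split_at [:: i.+1; N.-1] [:: i.-1] -> has_pattern G.
Proof.
move=> emb; apply: (@has_theta _ N.+1 i.+1 j.+1).
  by rewrite /house_theta; lia.
move: emb.
embed_by (fun x => if x < i then x else if x == i then N else x.-1).
Qed.

Lemma branch_split_second : split_at [:: i.-1; N.-1] [:: i.+1] -> has_pattern G.
Proof.
move=> emb; apply: (@has_theta _ N.+1 i j.+1).
  by rewrite /house_theta; lia.
move: emb.
embed_by (fun x => if x < i.+1 then x else if x == i.+1 then N else x.-1).
Qed.

Lemma branch_split_third : split_at [:: i.-1; i.+1] [:: N.-1] -> has_pattern G.
Proof.
move=> emb; apply: (@has_theta _ N.+1 i j).
  by rewrite /house_theta; lia.
move: emb; embed_by (fun x : nat => x).
Qed.

(** The shared neighbor forms a triangle with [i] and [N]; three paths lead from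
    it to [j].  If the cycle through [N], the second and the third path has
    length at least 4, it avoids the first path, and [i] caps its edge between
    [N] and [i + 1].  Otherwise the second path is an edge and the third has
    length 2, so that the first has length at least 3; then [N] caps the edge
    from [i] to [j] in the cycle through the first path. *)
Lemma branch_share_second :
  split_at [:: i.-1; i.+1] [:: i.+1; N.-1] -> has_pattern G.
Proof.
case: (ltnP i.+3 N) => [third_long | third_short].
  move=> emb; apply: (@has_capped_cycle _ (N - i).+1); first lia.
  move: emb.
  embed_by (fun x => if x == 0 then i else if x == 1 then N else x + i.-1).
have [i_gt1 ej] : 1 < i /\ j = i.+1 by lia.
move=> emb; apply: (@has_capped_cycle _ i.+3); first lia.
move: emb.
embed_by (fun x =>
  if x == 0 then N else if x == 1 then i else if x == 2 then j else x - 3).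
Qed.

(** The triangle is now [i - 1], [i], [N].  If the second path has an inner
    vertex, deleting its inner vertices makes [i] cap the edge from [i - 1] to
    [N] in the cycle through the first and the third path.  If it is an edge and
    [i - 1] is not adjacent to [j], deleting the inner vertices of the first
    path other than [i - 1] makes [i - 1] cap the edge from [i] to [N] in the
    cycle through the third path.  In the remaining case [i - 1] is adjacent to
    [N], [i] and [j], which are consecutive on that same cycle: a twin wheel
    with center [i - 1]. *)
Lemma branch_share_first :
  split_at [:: i.-1; i.+1] [:: i.-1; N.-1] -> has_pattern G.
Proof.
case: (ltnP i.+1 j) => [second_long | second_short].
  move=> emb; apply: (@has_capped_cycle _ (N - j + i).+2); first lia.
  move: emb.
  embed_by (fun x =>
    if x == 0 then i else if x == 1 then i.-1 else if x == 2 then N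
    else if x < 3 + (N - j) then N + 2 - x else x + j - N - 3).
have ej : j = i.+1 by lia.
case: (ltnP 1 i) => [first_long | first_short].
  move=> emb; apply: (@has_capped_cycle _ (N - j).+3); first lia.
  move: emb.
  embed_by (fun x =>
    if x == 0 then i.-1 else if x == 1 then i else if x == 2 then N
    else N + 2 - x).
have ei : i = 1 by lia.
move=> emb; right; exists N => //; move: emb.
embed_by (fun x => if x == 0 then N else if x == N then 0 else x).
Qed.

(** Exchanging the first and the third path, which keeps the branch vertex that
    is split, turns a shared third neighbor into a shared first one. *)
Lemma branch_reflect : split_at [:: i.+1; N.-1] [:: i.-1; N.-1] ->
  let i' := (N - j).-1 in let j' := N - i.+1 in
  embeds N.+1 (split_vertex (theta N i' j') N i'
    (mem [:: i'.-1; i'.+1]) (mem [:: i'.-1; N.-1])) G.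
Proof.
move=> + i' j'; rewrite /i' /j' => {i' j'} /split_relabel relabel.
apply: (relabel _ _ _ _ (fun x => if x < (N - j).-1 then x + j.+1 else
  if x < N - i then x + i + j + 1 - N else x + i - N)); relabel_by.
Qed.

End ThetaSplit.

(** If neither part of the split vertex sees both neighbors, then they see one
    each, and splitting amounts to subdividing an edge. *)
Lemma theta_split_path (G : sgraph) N i j k :
  house_theta N i j -> k < N -> k != i -> k != j ->
  vertex_split G N (theta N i j) k -> has_pattern G.
Proof.
move=> Nij kN ki kj sk.
have [i_gt0 lt_ij lt_jN N_gt4] : [/\ 0 < i, i < j, j.+1 < N & 4 < N].
  by case/and5P: Nij.
have nbs := path_neighbors i_gt0 lt_ij lt_jN N_gt4 kN ki kj.
have [cu [cv [cov emb]]] := vertex_split_neighbors sk nbs kN.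
have emb' := vertex_split_swap kN emb.
move: cov emb emb'; rewrite /= andbT.
do 2!case: (cu _); do 2!case: (cv _); move=> //= _ emb emb'.
all: first
  [ by apply: has_theta Nij _; apply: split_full nbs kN emb
  | by apply: has_theta Nij _; apply: split_full nbs kN emb'
  | exact: path_split emb | exact: path_split emb' ].
Qed.

(** Unless one part of the split vertex sees all three neighbors, the parts
    separate them or share one; up to exchanging the parts, these are the cases
    treated above. *)
Lemma theta_split_branch (G : sgraph) N i j : house_theta N i j ->
  vertex_split G N (theta N i j) i -> has_pattern G.
Proof.
move=> Nij si.
have [i_gt0 lt_ij lt_jN N_gt4] : [/\ 0 < i, i < j, j.+1 < N & 4 < N].
  by case/and5P: Nij.
have iN : i < N by lia.
have nbs := branch_neighbors i_gt0 lt_ij lt_jN N_gt4.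
have share3 s t : s = [:: i.+1; N.-1] -> t = [:: i.-1; N.-1] ->
    embeds N.+1 (split_vertex (theta N i j) N i (mem s) (mem t)) G ->
    has_pattern G.
  move=> -> -> /branch_reflect-/(_ i_gt0 lt_ij lt_jN N_gt4).
  by apply: branch_share_first => //; lia.
have [cu [cv [cov emb]]] := vertex_split_neighbors si nbs iN.
have emb' := vertex_split_swap iN emb.
move: cov emb emb'; rewrite /= andbT.
do 3!case: (cu _); do 3!case: (cv _); move=> //= _ emb emb'.
all: first
  [ by apply: has_theta Nij _; apply: split_full nbs iN emb
  | by apply: has_theta Nij _; apply: split_full nbs iN emb'
  | by apply: branch_split_first emb | by apply: branch_split_first emb'
  | by apply: branch_split_second emb | by apply: branch_split_second emb'
  | by apply: branch_split_third emb | by apply: branch_split_third emb'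
  | by apply: branch_share_first emb | by apply: branch_share_first emb'
  | by apply: branch_share_second emb | by apply: branch_share_second emb'
  | by apply: share3 emb | by apply: share3 emb' ].
Qed.

Lemma theta_split (G : sgraph) N i j k : house_theta N i j -> k < N ->
  vertex_split G N (theta N i j) k -> has_pattern G.
Proof.
move=> Nij kN sk; case: (k =P i) => [ek|/eqP ki].
  by move: sk; rewrite ek; apply: theta_split_branch.
case: (k =P j) => [ek|/eqP kj]; last exact: theta_split_path sk.
have [i_gt0 lt_ij lt_jN N_gt4] : [/\ 0 < i, i < j, j.+1 < N & 4 < N].
  by case/and5P: Nij.
apply: (@theta_split_branch _ N (N - j.+1) (N - i.+1)).
  by move: Nij; rewrite /house_theta; lia.
(* reversing the Hamiltonian path exchanges the branch vertices *)
move: sk; rewrite ek => /vertex_split_relabel relabel.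
apply: (relabel _ _ (fun x => N - x.+1)); relabel_by.
Qed.

(** * Splitting a vertex of a twin wheel *)

Section TwinWheelSplit.

Variables (G : sgraph) (n : nat).
Hypothesis n_gt4 : 4 < n.

Let split_at k (s t : seq nat) :=
  embeds n.+2 (split_vertex (twin_wheel n) n.+1 k (mem s) (mem t)) G.

Let has_next_wheel : embeds n.+2 (twin_wheel n.+1) G -> has_pattern G.
Proof. by move=> emb; right; exists n.+1; first lia. Qed.

Let rim_next k := if k == n.-1 then 0 else k.+1.

Lemma rim_neighbors k : 2 < k -> k < n ->
  neighbors (twin_wheel n) n.+1 k [:: k.-1; rim_next k].
Proof. by move=> k_gt2 lt_kn; rewrite /rim_next; list_neighbors. Qed.

(** The hubs are the twins [1] and [n]; the corners are their common neighbors
    [0] and [2]. *)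
Lemma hub_neighbors : neighbors (twin_wheel n) n.+1 1 [:: 0; 2; n].
Proof. list_neighbors. Qed.

Lemma corner_neighbors : neighbors (twin_wheel n) n.+1 0 [:: 1; n.-1; n].
Proof. list_neighbors. Qed.

Lemma rim_split k : 2 < k -> k < n ->
  split_at k [:: rim_next k] [:: k.-1] -> has_pattern G.
Proof.
move=> k_gt2 lt_kn emb; apply: has_next_wheel; move: emb; rewrite /rim_next.
embed_by (fun x => if x < k then x else if x == k then n.+1 else x.-1).
Qed.

(** If one part of the split hub has exactly two neighbors, the other part is
    deleted.  When the two neighbors are the corners, the remaining part, the
    twin [n] and the long part of the rim are three paths between them, of
    lengths 2, 2 and at least 3. *)
Lemma hub_split_02 t : split_at 1 [:: 0; 2] t -> has_pattern G.
Proof.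
move=> emb; apply: (@has_theta _ n.+1 1 3).
  by rewrite /house_theta; lia.
move: emb.
embed_by (fun x =>
  if x == 0 then 1 else if x == 1 then 0 else if x == 2 then n else x.-1).
Qed.

(** When the two neighbors are [n] and a corner, the remaining part caps an edge
    of the cycle that [n] forms with the long part of the rim. *)
Lemma hub_split_0n t : split_at 1 [:: 0; n] t -> has_pattern G.
Proof.
move=> emb; apply: (@has_capped_cycle _ n.+1); first lia.
move: emb.
embed_by (fun x =>
  if x == 0 then 1 else if x == 1 then 0 else if x == 2 then n else x.-1).
Qed.

Lemma hub_split_2n t : split_at 1 [:: 2; n] t -> has_pattern G.
Proof.
move=> emb; apply: (@has_capped_cycle _ n.+1); first lia.
move: emb.
embed_by (fun x =>
  if x == 0 then 1 else if x == 1 then 2 else if x == 2 then n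
  else if x == 3 then 0 else n + 3 - x).
Qed.

(** A part of the split corner that sees one of the hubs and the neighbor
    [n - 1] replaces it on the rim; the other hub caps the edge between that hub
    and [2]. *)
Lemma corner_split_1 t : split_at 0 [:: 1; n.-1] t -> has_pattern G.
Proof.
move=> emb; apply: (@has_capped_cycle _ n.+1); first lia.
move: emb; embed_by (fun x => if x == 0 then n else if x == n then 0 else x).
Qed.

Lemma corner_split_n t : split_at 0 [:: n.-1; n] t -> has_pattern G.
Proof.
move=> emb; apply: (@has_capped_cycle _ n.+1); first lia.
move: emb.
embed_by (fun x =>
  if x == 0 then 1 else if x == 1 then n else if x == n then 0 else x).
Qed.

(** A part that sees both hubs is the new corner, and the other part a new rim
    vertex between it and [n - 1]. *)
Lemma corner_split_1n : split_at 0 [:: n.-1] [:: 1; n] -> has_pattern G.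
Proof.
move=> emb; apply: has_next_wheel; move: emb.
embed_by (fun x =>
  if x == 0 then n.+1 else if x == n then 0 else if x == n.+1 then n else x).
Qed.

Let full k ns t : neighbors (twin_wheel n) n.+1 k ns -> k < n.+1 ->
  split_at k ns t -> has_pattern G.
Proof.
by move=> nbs kn emb; right; exists n; last apply: split_full nbs kn emb.
Qed.

Lemma rim_vertex_split k : 2 < k -> k < n ->
  vertex_split G n.+1 (twin_wheel n) k -> has_pattern G.
Proof.
move=> k_gt2 lt_kn sk; have kn : k < n.+1 by lia.
have nbs := rim_neighbors k_gt2 lt_kn.
have [cu [cv [cov emb]]] := vertex_split_neighbors sk nbs kn.
have emb' := vertex_split_swap kn emb.
move: cov emb emb'; rewrite /= andbT.
do 2!case: (cu _); do 2!case: (cv _); move=> //= _ emb emb'.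
all: first [ exact: full nbs kn emb | exact: full nbs kn emb'
           | exact: rim_split emb | exact: rim_split emb' ].
Qed.

Lemma hub_vertex_split :
  vertex_split G n.+1 (twin_wheel n) 1 -> has_pattern G.
Proof.
move=> sk; have kn : 1 < n.+1 by lia.
have nbs := hub_neighbors.
have [cu [cv [cov emb]]] := vertex_split_neighbors sk nbs kn.
have emb' := vertex_split_swap kn emb.
move: cov emb emb'; rewrite /= andbT.
do 3!case: (cu _); do 3!case: (cv _); move=> //= _ emb emb'.
all: first [ exact: full nbs kn emb | exact: full nbs kn emb'
           | exact: hub_split_02 emb | exact: hub_split_02 emb'
           | exact: hub_split_0n emb | exact: hub_split_0n emb'
           | exact: hub_split_2n emb | exact: hub_split_2n emb' ].
Qed.

Lemma corner_vertex_split :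
  vertex_split G n.+1 (twin_wheel n) 0 -> has_pattern G.
Proof.
move=> sk; have kn : 0 < n.+1 by [].
have nbs := corner_neighbors.
have [cu [cv [cov emb]]] := vertex_split_neighbors sk nbs kn.
have emb' := vertex_split_swap kn emb.
move: cov emb emb'; rewrite /= andbT.
do 3!case: (cu _); do 3!case: (cv _); move=> //= _ emb emb'.
all: first [ exact: full nbs kn emb | exact: full nbs kn emb'
           | exact: corner_split_1 emb | exact: corner_split_1 emb'
           | exact: corner_split_n emb | exact: corner_split_n emb'
           | exact: corner_split_1n emb | exact: corner_split_1n emb' ].
Qed.

Lemma twin_wheel_split k : k < n.+1 ->
  vertex_split G n.+1 (twin_wheel n) k -> has_pattern G.
Proof.
move=> kn sk; case: (k =P 0) => [ek|/eqP k0].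
  by apply: corner_vertex_split; rewrite -ek.
case: (k =P 1) => [ek|/eqP k1]; first by apply: hub_vertex_split; rewrite -ek.
case: (k =P n) => [ek|/eqP kn'].
  (* exchanging the twins *)
  apply: hub_vertex_split.
  move: sk; rewrite ek => /vertex_split_relabel relabel.
  apply: (relabel _ _ (fun x => if x == 1 then n else if x == n then 1 else x));
    relabel_by.
case: (k =P 2) => [ek|/eqP k2]; last by apply: rim_vertex_split sk; lia.
(* reflecting the rim in [1] *)
apply: corner_vertex_split.
move: sk; rewrite ek => /vertex_split_relabel relabel.
apply: (relabel _ _ (fun x =>
  if x < 3 then 2 - x else if x == n then n else n + 2 - x)); relabel_by.
Qed.

End TwinWheelSplit.

(** * Contracting an edge creates no pattern *)

Lemma contract_pattern (G : sgraph) (u v : G) :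
  adj u v -> has_pattern (contract u v) -> has_pattern G.
Proof.
move=> uv [[N [i [j [Nij]]]]|[n n_gt4]] /(contract_embeds uv) [emb|[k kN sk]].
- exact: has_theta emb.
- exact: theta_split sk.
- by right; exists n.
- exact: twin_wheel_split sk.
Qed.

Lemma delete_pattern (G : sgraph) (v : G) :
  has_pattern (delete_vertex v) -> has_pattern G.
Proof.
move=> [[N [i [j [Nij]]]]|[n n_gt4]] /delete_embeds emb.
  exact: has_theta emb.
by right; exists n.
Qed.

(** * Induced subgraphs as injections *)

Definition induced_in (K G : sgraph) : Prop :=
  exists2 f : K -> G, injective f & forall x y, adj (f x) (f y) = adj x y.

Lemma induced_inP (G K : sgraph) : contains_induced G K <-> induced_in K G.
Proof.
split=> [[S [f [g fK gK] fA]]|[f f_inj fA]].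
  exists (fun x => val (g x)) => [x y /val_inj/(can_inj gK)//|x y].
  by rewrite -[in RHS](gK x) -[in RHS](gK y) fA.
pose S := f @: [set: K]; have fS x : f x \in S by apply: imset_f; rewrite inE.
have inv (z : induced S) : exists x, f x == val z.
  by have /imsetP[x _ ->] := valP z; exists x.
exists S; exists (fun z => xchoose (inv z)).
  exists (fun x => Sub (f x) (fS x)) => [z|x].
    by apply: val_inj; rewrite /=; apply/eqP/(xchooseP (inv z)).
  by apply: f_inj; apply/eqP/(xchooseP (inv _)).
by move=> x y; rewrite -fA !(eqP (xchooseP (inv _))).
Qed.

(** [K] is, up to isomorphism, the graph on [0, ..., N - 1] given by [r]. *)
Definition models N r (K : sgraph) := #|K| = N /\ embeds N r K.

Lemma models_bij N r (K : sgraph) : models N r K ->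
  exists f : 'I_N -> K, bijective f /\
    forall x y : 'I_N, x < y -> adj (f x) (f y) = r x y.
Proof.
move=> [card_K [f fP]]; exists f; split=> [|x y xy]; last first.
  by have [] := fP x y xy (ltn_ord y).
apply: inj_card_bij; last by rewrite card_K card_ord.
move=> x y /eqP fxy; apply: val_inj; case: (ltngtP x y) => // lt; exfalso.
  by have [] := fP _ _ lt (ltn_ord _); rewrite fxy.
by have [] := fP _ _ lt (ltn_ord _); rewrite eq_sym fxy.
Qed.

Lemma models_induced_in N r (K G : sgraph) :
  models N r K -> embeds N r G -> induced_in K G.
Proof.
move=> /models_bij[f [[g fK gK] fA]] [h hP]; exists (h \o val \o g).
  move=> x y /= /eqP hxy; apply: (can_inj gK); apply: val_inj.
  case: (ltngtP (g x) (g y)) => // lt; exfalso.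
    by have [] := hP _ _ lt (ltn_ord _); rewrite hxy.
  by have [] := hP _ _ lt (ltn_ord _); rewrite eq_sym hxy.
have main x y : g x < g y -> adj (h (g x)) (h (g y)) = adj x y.
  by move=> lt; have [_ ->] := hP _ _ lt (ltn_ord _); rewrite -fA // !gK.
move=> x y /=; case: (ltngtP (g x) (g y)) => [lt|lt|]; first exact: main.
  by rewrite adj_sym main // adj_sym.
by move/val_inj/(can_inj gK) => ->; rewrite !adj_irrefl.
Qed.

Lemma models_isomorphic N r (K G : sgraph) :
  models N r K -> models N r G -> isomorphic K G.
Proof.
move=> mK [card_G eG]; have [f f_inj fA] := models_induced_in mK eG.
by exists f => //; apply: inj_card_bij; rewrite // card_G (proj1 mK).
Qed.

(** * Thetas are the subdivisions of the house *)

(** The edge between [a] and [b] is subdivided by a new vertex [m], the vertices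
    from [m] on being shifted by one. *)
Definition subdivided (r : rel nat) m a b : rel nat := fun x y =>
  let old z := if z < m then z else z.-1 in
  if x == m then (old y == a) || (old y == b)
  else if y == m then (old x == a) || (old x == b)
  else r (old x) (old y) && ~~ ((old x == a) && (old y == b)).

Lemma models_subdivided (H K : sgraph) N r m a b r' :
  subdivision H K -> models N r K -> m <= N -> a < b -> b < N -> r a b ->
  (forall x y, x < y -> y < N.+1 -> r' x y = subdivided r m a b x y) ->
  exists2 K', subdivision H K' & models N.+1 r' K'.
Proof.
move=> HK [card_K [f fP]] mN ab bN rab r'E.
have [fab adj_ab] := fP a b ab bN.
exists (subdivide_edge (f a) (f b)).
  by apply: SubdivisionStep; rewrite ?adj_ab.
split; first by rewrite card_option card_K.
have fE x y : x < N -> y < N -> (f x == f y) = (x == y).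
  move=> xN yN; case: (x =P y) => [->|/eqP xy]; first exact: eqxx.
  by apply/negbTE; have [] := embeds_upper fP xN yN xy.
pose old z := if z < m then z else z.-1.
exists (fun x => if x == m then None else Some (f (old x))) => x y xy yN.
rewrite r'E // /subdivided -/(old x) -/(old y).
have aN : a < N by lia.
have oldN z : z < N.+1 -> z != m -> old z < N by rewrite /old; case: ifP; lia.
case: (x =P m) => [ex|/eqP xm].
  have ym : y != m by lia.
  by rewrite (negbTE ym) /= !fE //; apply: oldN.
have ltx : old x < N by apply: oldN => //; lia.
case: (y =P m) => [ey|/eqP ym] /=; first by rewrite !fE.
have lty : old y < N by apply: oldN.
have ltxy : old x < old y by move: xm ym; rewrite /old; do 2!case: ifP; lia.
have [fxy ->] := fP _ _ ltxy lty; split=> //.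
rewrite !fE //; congr (_ && ~~ _); case: (_ && _) => //=.
by apply/negbTE/negP => /andP[/eqP ? /eqP ?]; lia.
Qed.

Lemma models_relabel M r' N r (K : sgraph) (g : nat -> nat) :
  models N r K -> M = N ->
  (forall x y, x < y -> y < M -> forall a b, a = g x -> b = g y ->
    [/\ a < N, b < N, a != b & r' x y = upper r a b]) ->
  models M r' K.
Proof.
by move=> [card_K emb] -> gP; split=> //; apply: embeds_sub emb gP.
Qed.

Lemma house_models : models 5 (theta 5 1 2) house.
Proof.
split; first exact: card_ord.
(* the vertices e, a, d, c, b *)
exists (fun x => inord (nth 0 [:: 4; 0; 3; 2; 1] x)) => x y xy y5.
rewrite /= /house_adj -val_eqE /=.
move: y5 xy; do 5?[case: y => [|y] //=]; do 4?[case: x => [|x] //=];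
  by rewrite !inordK.
Qed.

Definition subdivides_house N r :=
  exists2 K, subdivision house K & models N r K.

Lemma theta_longer_first N i j : house_theta N i j ->
  subdivides_house N (theta N i j) ->
  subdivides_house N.+1 (theta N.+1 i.+1 j.+1).
Proof.
move=> Nij [K HK mK].
have [i_gt0 lt_ij lt_jN N_gt4] : [/\ 0 < i, i < j, j.+1 < N & 4 < N].
  by case/and5P: Nij.
apply: (models_subdivided (m := 0) (a := 0) (b := j) HK mK); try lia.
  by rewrite /theta !eqxx orbT.
move=> x y xy yN; rewrite /theta /subdivided; clear Nij.
decide_ifs; decide_atoms.
Qed.

Lemma theta_longer_second N i j : house_theta N i j ->
  subdivides_house N (theta N i j) ->
  subdivides_house N.+1 (theta N.+1 i j.+1).
Proof.
move=> Nij [K HK mK].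
have [i_gt0 lt_ij lt_jN N_gt4] : [/\ 0 < i, i < j, j.+1 < N & 4 < N].
  by case/and5P: Nij.
apply: (models_subdivided (m := j) (a := j.-1) (b := j) HK mK); try lia.
  by rewrite /theta prednK ?eqxx //; lia.
move=> x y xy yN; rewrite /theta /subdivided; clear Nij.
decide_ifs; decide_atoms.
Qed.

Lemma theta_longer_third N i j : house_theta N i j ->
  subdivides_house N (theta N i j) ->
  subdivides_house N.+1 (theta N.+1 i j).
Proof.
move=> Nij [K HK mK].
have [i_gt0 lt_ij lt_jN N_gt4] : [/\ 0 < i, i < j, j.+1 < N & 4 < N].
  by case/and5P: Nij.
apply: (models_subdivided (m := N) (a := i) (b := N.-1) HK mK); try lia.
  by rewrite /theta !eqxx !orbT.
move=> x y xy yN; rewrite /theta /subdivided; clear Nij.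
decide_ifs; decide_atoms.
Qed.

(** One of the three paths can be shortened, unless the theta is the house
    itself.  Shortening must not lead to the path lengths 2, 2, 2, nor make the
    first or the third path an edge: the numbering requires inner vertices on
    both.  Only for the lengths 2, 3, 2 does this exclude every path; permuting
    the paths to 2, 2, 3 allows to shorten the second one. *)
Lemma theta_subdivision N i j :
  house_theta N i j -> subdivides_house N (theta N i j).
Proof.
elim: N i j => [|N IH] i j Nij; first by move: Nij; rewrite /house_theta; lia.
have [i_gt0 lt_ij lt_jN N_gt4] : [/\ 0 < i, i < j, j.+1 < N.+1 & 4 < N.+1].
  by case/and5P: Nij.
have first_shorter i' j' : house_theta N i' j' ->
    subdivides_house N.+1 (theta N.+1 i'.+1 j'.+1).
  by move=> h; apply: theta_longer_first (IH _ _ h).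
have second_shorter i' j' : house_theta N i' j' ->
    subdivides_house N.+1 (theta N.+1 i' j'.+1).
  by move=> h; apply: theta_longer_second (IH _ _ h).
have third_shorter i' j' : house_theta N i' j' ->
    subdivides_house N.+1 (theta N.+1 i' j').
  by move=> h; apply: theta_longer_third (IH _ _ h).
case: (ltnP N 5) => [N_lt5|N_gt4'].
  have eN : N = 4 by lia.
  case: (i =P 1) => [ei|/eqP i1].
    have ej : j = 2 by move: Nij; rewrite /house_theta; lia.
    rewrite eN ei ej; exists house; first exact: SubdivisionRefl.
    exact: house_models.
  (* the house numbered in reverse order *)
  have [ei ej] : i = 2 /\ j = 3 by lia.
  rewrite eN ei ej; exists house; first exact: SubdivisionRefl.
  apply: (models_relabel (g := fun x => 4 - x) house_models) => //.
  move=> x y xy yM a b -> ->; (split; [lia|lia|lia|]).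
  by rewrite /upper /theta; decide_ifs; decide_atoms.
case: (j =P i.+1) => [ej|/eqP ji].
  case: (ltnP 1 i) => [i_gt1|i_le1].
    have -> : i = i.-1.+1 by lia.
    have -> : j = j.-1.+1 by lia.
    by apply: first_shorter; rewrite /house_theta; lia.
  by apply: third_shorter; rewrite /house_theta; lia.
case: (boolP [&& N == 5, i == 1 & j == 4])
  => [/and3P[/eqP eN /eqP ei /eqP ej]|other].
  have [|K HK mK] := second_shorter 1 2; first by rewrite eN.
  rewrite eN ei ej in mK *; exists K => //.
  apply: (models_relabel (g := fun x => if x < 2 then x else 7 - x) mK) => //.
  move=> x y xy yM a b; case: ltnP => ? ->; case: ltnP => ? ->; prune;
    (split; [lia|lia|lia|]); rewrite /upper /theta; decide_ifs; decide_atoms.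
have -> : j = j.-1.+1 by lia.
by apply: second_shorter; rewrite /house_theta; lia.
Qed.

Lemma theta_contains_subdivision (G : sgraph) N i j :
  house_theta N i j -> embeds N (theta N i j) G ->
  contains_induced_subdivision G house.
Proof.
move=> Nij emb; have [K HK mK] := theta_subdivision Nij.
by exists K => //; apply/induced_inP/(models_induced_in mK emb).
Qed.

(** * Subdivisions of the house contract to the house *)

Lemma del_contr_trans (G H K : sgraph) :
  del_contr G H -> del_contr H K -> del_contr G K.
Proof.
move=> GH; elim=> // [K' v _ IH|K' u v _ IH uv]; first exact: DelContrDelete.
exact: DelContrContract.
Qed.

Lemma induced_minor_del_contr (G H K : sgraph) :
  del_contr G K -> induced_minor H K -> induced_minor H G.
Proof. by move=> GK [L KL LH]; exists L => //; apply: del_contr_trans KL. Qed.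

Lemma induced_in_minor (G H : sgraph) : induced_in H G -> induced_minor H G.
Proof.
have [n] := ubnP #|G|; elim: n G => // n IH G; rewrite ltnS => Gn [f f_inj fA].
case: (pickP (fun v => v \notin codom f)) => [v vf|f_surj].
  apply: induced_minor_del_contr (DelContrDelete v (DelContrRefl G)) (IH _ _ _).
    by rewrite /= card_sig cardsC1; move: Gn; rewrite (cardD1 v) inE /=; lia.
  have fv x : f x \in [set~ v].
    by rewrite !inE; apply: contraNneq vf => <-; apply: codom_f.
  by exists (fun x => Sub (f x) (fv x)) => [x y [] /f_inj | x y];
    rewrite ?[LHS]fA.
exists G; first exact: DelContrRefl.
have fS y : exists x, f x == y.
  by have /negbFE/codomP[x ->] := f_surj y; exists x.
exists (fun y => xchoose (fS y)) => [|x y].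
  exists f => [y|x]; first exact/eqP/(xchooseP (fS y)).
  by apply: f_inj; apply/eqP/(xchooseP (fS _)).
by rewrite -fA !(eqP (xchooseP (fS _))).
Qed.

(** Contracting one half of a subdivided edge restores the edge. *)
Lemma induced_in_subdivide (G K : sgraph) (u v : K) : adj u v ->
  induced_in (subdivide_edge u v) G ->
  exists2 G', del_contr G G' & induced_in K G'.
Proof.
move=> uv [f f_inj fA].
exists (contract (f (Some u)) (f None)).
  by apply: DelContrContract; [apply: DelContrRefl | rewrite fA /= eqxx].
have fN x : f (Some x) != f None by apply/eqP => /f_inj.
exists (fun x => Sub (f (Some x)) (fN x)) => [x y [] /f_inj[]//|x y].
rewrite contract_adjE /= -val_eqE /= !(inj_eq f_inj) !fA /=.
case: (x =P y) => [->|/eqP xy] /=; first by rewrite eqxx adj_irrefl.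
rewrite !(inj_eq Some_inj) xy /=.
have [exu|_] := eqVneq x u; have [eyv|_] := eqVneq y v;
  have [eyu|_] := eqVneq y u; have [exv|_] := eqVneq x v;
  rewrite ?andbF ?andbT ?orbF //= ?orbT.
all: first [ by rewrite exu eyv uv | by rewrite exv eyu adj_sym uv
           | by rewrite exu eyu eqxx in xy | by rewrite exv eyv eqxx in xy ].
Qed.

Lemma subdivision_minor (G K : sgraph) :
  subdivision house K -> induced_in K G -> induced_minor house G.
Proof.
move=> HK; elim: HK G => [|{}K u v _ IH uv] G; first exact: induced_in_minor.
move=> /(induced_in_subdivide uv)[G' GG' KG'].
exact: induced_minor_del_contr GG' (IH _ KG').
Qed.

(** * Long twin wheels *)

Definition cycle_rel n : rel nat :=
  fun x y => (y == x.+1) || (x == 0) && (y == n.-1).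

Lemma cycle_models n : 2 < n -> models n (cycle_rel n) (cycle_graph n).
Proof.
case: n => // n n_gt1; split; first exact: card_ord.
exists inord => x y xy yn; have xn := ltn_trans xy yn.
have inordE z : z < n.+1 -> (inord z : 'I_n.+1) = z :> nat by exact: inordK.
rewrite /= /cycle_adj -!val_eqE /= !inordE // /cycle_rel (ltn_eqF xy) /=.
split=> //.
rewrite [x.+1 %% _]modn_small //; last by lia.
congr (_ || _).
case: (ltngtP y n) => [lt|lt|->].
- rewrite modn_small //; lia.
- lia.
- by rewrite modnn /=; lia.
Qed.

Section TwinWheelGraph.

Variable n : nat.
Hypothesis n_gt4 : 4 < n.

Let wheel_adj : rel 'I_n.+1 := fun x y => (x != y) && upper (twin_wheel n) x y.

Fact wheel_sym : symmetric wheel_adj.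
Proof.
move=> x y; rewrite /wheel_adj eq_sym; have [//|xy] := eqVneq y x.
by rewrite upper_sym // eq_sym.
Qed.

Fact wheel_irrefl : irreflexive wheel_adj.
Proof. by move=> x; rewrite /wheel_adj eqxx. Qed.

Definition wheel_graph : sgraph := SGraph wheel_sym wheel_irrefl.

Lemma wheel_models : models n.+1 (twin_wheel n) wheel_graph.
Proof.
split; first exact: card_ord.
exists inord => x y xy yn; have xn := ltn_trans xy yn.
have inordE z : z < n.+1 -> (inord z : 'I_n.+1) = z :> nat by exact: inordK.
by rewrite /= /wheel_adj -!val_eqE /= !inordE // (ltn_eqF xy) /upper xy.
Qed.

Lemma wheel_rim_models :
  models n (cycle_rel n) (induced [set~ (ord_max : wheel_graph)]).
Proof.
split; first by rewrite /= card_sig cardsC1 card_ord.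
have in_rim x : x < n -> (inord x : 'I_n.+1) \in [set~ ord_max].
  by move=> xn; rewrite !inE -val_eqE /= inordK; lia.
have n_gt0 : 0 < n by lia.
pose x0 : induced [set~ (ord_max : wheel_graph)] :=
  Sub (inord 0) (in_rim 0 n_gt0).
exists (fun x => insubd x0 (inord x)) => x y xy yn; have xn := ltn_trans xy yn.
have [xn' yn'] : x < n.+1 /\ y < n.+1 by lia.
rewrite -val_eqE /= /induced_adj !val_insubd !in_rim //= /wheel_adj.
rewrite -!val_eqE /= !inordK // /cycle_rel /upper xy /twin_wheel.
by rewrite (ltn_eqF xy) (ltn_eqF yn).
Qed.

Lemma wheel_nbhd (x : wheel_graph) :
  (x \in nbhd (ord_max : wheel_graph)) = (x < 3).
Proof.
rewrite inE /= /wheel_adj /upper /twin_wheel -val_eqE /= eqxx.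
by have := ltn_ord x; case: ltngtP => //=; lia.
Qed.

Lemma wheel_graph_twin_wheel : long_twin_wheel wheel_graph.
Proof.
have lt3n : 3 <= n.+1 by lia.
have card_nbhd : #|nbhd (ord_max : wheel_graph)| = 3.
  have -> : nbhd (ord_max : wheel_graph) = [set widen_ord lt3n x | x in 'I_3].
    apply/setP => x; rewrite wheel_nbhd; apply/idP/imsetP => [x3|[y _ ->]] /=.
      by exists (Ordinal x3) => //; apply: val_inj.
    exact: ltn_ord y.
  rewrite card_imset ?card_ord // => x y /(congr1 val) /= xy.
  exact: val_inj.
exists [set~ ord_max], ord_max; split=> //.
  exists n => //.
  by apply: models_isomorphic wheel_rim_models (cycle_models _); lia.
split; first by rewrite /= card_sig card_nbhd.
have lt1n : 1 < n.+1 by lia.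
have h1 : (Ordinal lt1n : wheel_graph) \in nbhd (ord_max : wheel_graph).
  by rewrite wheel_nbhd.
pose h : induced (nbhd (ord_max : wheel_graph)) := Sub (Ordinal lt1n) h1.
have to_h x : connect (@adj (induced (nbhd (ord_max : wheel_graph)))) h x.
  have [->|xh] := eqVneq x h; first exact: connect0.
  apply: connect1; move: xh; have := valP x; rewrite wheel_nbhd.
  rewrite -val_eqE /= /induced_adj /= /wheel_adj -!val_eqE /= eq_sym => x3 xh.
  rewrite xh /upper /twin_wheel; decide_ifs; decide_atoms.
move=> x y; apply: connect_trans (to_h y).
rewrite (sym_connect_sym _); first exact: to_h.
exact: adj_sym.
Qed.

End TwinWheelGraph.

Lemma twin_wheel_contained (G : sgraph) n :
  4 < n -> embeds n.+1 (twin_wheel n) G -> contains_induced_long_twin_wheel G.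
Proof.
move=> n_gt4 emb; exists (wheel_graph n); first exact: wheel_graph_twin_wheel.
exact/induced_inP/(models_induced_in (wheel_models n) emb).
Qed.

Section TwinWheelExtract.

Variables (W : sgraph) (n : nat) (v : W).
Hypothesis n_gt4 : 4 < n.
Hypothesis card_nbhd : #|nbhd v| = 3.
Hypothesis nbhd_conn : connected (induced (nbhd v)).

(** Each of the three neighbors is adjacent to another one, so at least two of
    the three possible edges are present, and these share a vertex. *)
Lemma nbhd_middle : exists2 m, m \in nbhd v &
  forall x, x \in nbhd v -> x != m -> adj m x.
Proof.
have has_nbr x : x \in nbhd v -> exists2 y, y \in nbhd v & adj x y.
  move=> xv; have : 0 < #|nbhd v :\ x|.
    by move: card_nbhd; rewrite (cardsD1 x) xv; lia.
  case/card_gt0P => z; rewrite !inE => /andP[zx zv].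
  have zv' : z \in nbhd v by rewrite inE.
  have [_ /(_ (Sub x xv) (Sub z zv'))/connectP[[|y p] /=]] := nbhd_conn.
    by move=> _ /(congr1 val) /= zx'; rewrite zx' eqxx in zx.
  by move=> /andP[xy _] _; exists (val y); [apply: valP | apply: xy].
have /card_gt0P[x xv] : 0 < #|nbhd v| by rewrite card_nbhd.
have [y yv xy] := has_nbr x xv.
have yx : y != x by apply: contraTneq xy => ->; rewrite adj_irrefl.
have /card_gt0P[z] : 0 < #|nbhd v :\ x :\ y|.
  move: card_nbhd; rewrite (cardsD1 x) xv (cardsD1 y (_ :\ x)) in_setD1 yx yv.
  by lia.
rewrite !in_setD1 => /and3P[zy zx zv].
have nbhdE w : w \in nbhd v -> [|| w == x, w == y | w == z].
  move=> wv; apply: contraTT isT; rewrite !negb_or => /and3P[wx wy wz].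
  have : #|[set x; y; z; w]| <= #|nbhd v|.
    apply/subset_leq_card/subsetP => t.
    by rewrite !in_setU !in_set1 => /orP[/orP[/orP[]|]|] /eqP->.
  by rewrite card_nbhd -!setUA !cardsU1 !inE cards1 !negb_or
       eq_sym yx (eq_sym x z) zx (eq_sym x w) wx (eq_sym y z) zy (eq_sym y w) wy
       (eq_sym z w) wz.
have [w wv zw] := has_nbr z zv.
have wz : w != z by apply: contraTneq zw => ->; rewrite adj_irrefl.
have := nbhdE w wv; rewrite (negbTE wz) orbF => /orP[] /eqP ew.
  exists x => // t tv; have := nbhdE t tv.
  by case/or3P => /eqP-> //; rewrite ?eqxx // adj_sym -ew.
exists y => // t tv; have := nbhdE t tv.
by case/or3P => /eqP-> //; rewrite ?eqxx // adj_sym // -ew.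
Qed.

Hypothesis rim_cycle : isomorphic (induced [set~ v]) (cycle_graph n).

(** Numbering the rim so that the middle neighbor of the center is [1]. *)
Lemma twin_wheel_embeds : embeds n.+1 (twin_wheel n) W.
Proof.
have [f [g fK gK] fA] := rim_cycle.
case: n n_gt4 f g fK gK fA => // p p_gt3 f g fK gK fA.
pose rim t : W := val (g (inord (t %% p.+1))).
have inordE t : (inord (t %% p.+1) : 'I_p.+1) = t %% p.+1 :> nat.
  by rewrite inordK // ltn_pmod.
have rim_eq s t : (rim s == rim t) = (s == t %[mod p.+1]).
  by rewrite /rim (inj_eq val_inj) (can_eq gK) -val_eqE /= !inordE.
have rim_adj s t : adj (rim s) (rim t) = (s != t %[mod p.+1]) &&
    ((t == s + 1 %[mod p.+1]) || (s == t + 1 %[mod p.+1])).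
  rewrite -[LHS]/(adj (g (inord (s %% p.+1))) (g (inord (t %% p.+1)))).
  rewrite -fA !gK /= /cycle_adj -!val_eqE /= !inordE.
  by rewrite -[(s %% _).+1]addn1 -[(t %% _).+1]addn1 !modnDml.
have rim_onto w : w != v -> exists t, w = rim t.
  move=> wv; have wC : w \in [set~ v] by rewrite in_setC1.
  by exists (f (Sub w wC)); rewrite /rim modn_small ?ltn_ord // inord_val fK.
have rim_neq t : rim t != v.
  by have := valP (g (inord (t %% p.+1))); rewrite in_setC1.
have [m mv m_adj] := nbhd_middle.
have nbhd_neq w : w \in nbhd v -> w != v.
  by rewrite inE; apply: contraTneq => ->; rewrite adj_irrefl.
have [k mk] := rim_onto m (nbhd_neq m mv).
pose c := k + p.
have rim_k : rim k = rim (1 + c).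
  by apply/eqP; rewrite rim_eq /c addnC -addnA addn1 modnDr.
have nbhdE : nbhd v = [set rim c; rim (1 + c); rim (2 + c)].
  apply/eqP; rewrite eqEcard card_nbhd; apply/andP; split; last first.
    by rewrite -setUA !cardsU1 cards1; case: (_ \notin _); case: (_ \notin _).
  apply/subsetP => w wv; rewrite !in_setU !in_set1 -rim_k -mk.
  have [//|wm] := eqVneq w m; first by rewrite orbT.
  have := m_adj w wv wm; have [t ->] := rim_onto w (nbhd_neq w wv).
  rewrite mk rim_k rim_adj !rim_eq => /andP[_ /orP[]].
    by rewrite addnAC addn1 => ->; rewrite orbT.
  by rewrite addnC eqn_modDr eq_sym => ->.
exists (fun x => if x == p.+1 then v else rim (x + c)) => x y xy yn.
have xn : x < p.+1 by lia.
rewrite (ltn_eqF xn) /twin_wheel; case: (y =P p.+1) => [ey|/eqP yn'].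
  split=> //; rewrite adj_sym.
  have -> : adj v (rim (x + c)) = (rim (x + c) \in nbhd v) by rewrite !inE.
  rewrite nbhdE !in_setU !in_set1 !rim_eq -[c in _ == c %[mod _]]add0n.
  rewrite !eqn_modDr.
  by rewrite !modn_small //; lia.
have {}yn : y < p.+1 by lia.
rewrite rim_eq rim_adj eqn_modDr !(addnAC _ c 1) !eqn_modDr.
rewrite [x %% _]modn_small // [y %% _]modn_small // (ltn_eqF xy) /=; split=> //.
rewrite [(x + 1) %% _]modn_small; last by lia.
rewrite addn1; congr (_ || _).
case: (ltngtP y p) => [lt|lt|->].
- rewrite modn_small; lia.
- lia.
- by rewrite addn1 modnn; lia.
Qed.

End TwinWheelExtract.

(** Contracting the rim edge from [1] to [2] leaves the twin [n] adjacent to the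
    merged vertex and to [0] only, so that it caps an edge of the shorter
    rim. *)
Lemma twin_wheel_minor (G : sgraph) n :
  4 < n -> embeds n.+1 (twin_wheel n) G -> induced_minor house G.
Proof.
move=> n_gt4 [f fP]; have fU := embeds_upper fP.
have f12 : adj (f 1) (f 2).
  have [|_ ->] := fP 1 2 isT; first lia.
  by rewrite /twin_wheel; case: eqP => //; lia.
apply: induced_minor_del_contr (DelContrContract (DelContrRefl G) f12) _.
have capN2 : house_theta n 1 2 by rewrite /house_theta; lia.
suff emb : embeds n (theta n 1 2) (contract (f 1) (f 2)).
  have [K HK /induced_inP KG] := theta_contains_subdivision capN2 emb.
  exact: subdivision_minor HK KG.
pose s x := if x == 0 then n else if x == 1 then 0 else if x == 2 then 1 else x.
have sN x : x < n -> s x < n.+1 /\ s x != 2.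
  by rewrite /s; decide_ifs; lia.
have f2 x : x < n -> f (s x) != f 2.
  move=> xn; have [sx sx2] := sN x xn.
  by have [] := fU (s x) 2 sx _ sx2; first lia.
have n_gt0 : 0 < n by lia.
pose x0 : contract (f 1) (f 2) := Sub (f (s 0)) (f2 0 n_gt0).
exists (fun x => insubd x0 (f (s x))) => x y xy yn; have xn := ltn_trans xy yn.
have [sx sx2] := sN x xn; have [sy sy2] := sN y yn.
have sxy : s x != s y by move: xy xn yn; rewrite /s; decide_ifs; lia.
have [fxy fA] := fU _ _ sx sy sxy.
have f_eq a b : a < n.+1 -> b < n.+1 -> (f a == f b) = (a == b).
  move=> aN bN; have [->|ab] := eqVneq a b; first exact: eqxx.
  by apply/negbTE; have [] := fU a b aN bN ab.
have valE z : z < n -> val (insubd x0 (f (s z))) = f (s z).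
  by move=> zn; rewrite val_insubd f2.
have neq : insubd x0 (f (s x)) != insubd x0 (f (s y)).
  by rewrite -val_eqE !valE.
split=> //; rewrite contract_adjE neq -![sval _]/(val _) !valE //= fA.
have n2 : 2 < n.+1 by lia.
have n1 : 1 < n.+1 by lia.
have [|_ ->] := fU 2 (s y) n2 sy; first by rewrite eq_sym.
have [|_ ->] := fU 2 (s x) n2 sx; first by rewrite eq_sym.
rewrite !f_eq //; clear - xy yn n_gt4.
name_value (s x); rewrite {1}/s; substitute_value;
  name_value (s y); rewrite {1}/s; substitute_value;
  rewrite /upper /twin_wheel /theta; decide_ifs; decide_atoms.
Qed.

(** * The equivalence *)

Lemma del_contr_pattern (G K : sgraph) :
  del_contr G K -> has_pattern K -> has_pattern G.
Proof.
elim=> [|{}K v _ IH|{}K u v _ IH uv] //; first by move/delete_pattern.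
by move/(contract_pattern uv).
Qed.

Lemma house_pattern (K : sgraph) : isomorphic K house -> has_pattern K.
Proof.
move=> [f [g fK gK] fA]; apply: (@has_capped_cycle _ 5) => //.
have [_ [h hP]] := house_models; exists (g \o h) => x y xy y5.
by rewrite /= (can_eq gK) -fA !gK; apply: hP.
Qed.

Theorem theorem6p6 (G : sgraph) :
  ~ induced_minor house G <->
  ~ contains_induced_subdivision G house /\
  ~ contains_induced_long_twin_wheel G.
Proof.
split=> [no_minor|[no_sub no_wheel] [K GK KH]].
  split=> [[K HK /induced_inP KG]|].
    exact/no_minor/(subdivision_minor HK KG).
  move=> [W [C [v [-> [n n_gt4 rim] card3 conn]]] /induced_inP[h h_inj hA]].
  have [f fP] := twin_wheel_embeds n_gt4 card3 conn rim.
  apply/no_minor/(twin_wheel_minor n_gt4); exists (h \o f) => x y xy yn.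
  by rewrite /= (inj_eq h_inj) hA; apply: fP.
have := del_contr_pattern GK (house_pattern KH).
move=> [[N [i [j [Nij emb]]]]|[n n_gt4 emb]].
  exact/no_sub/(theta_contains_subdivision Nij emb).
exact/no_wheel/(twin_wheel_contained n_gt4 emb).
Qed.
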